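(* Let $N\ge1$ and let $S$ be a 2-string with $|S|=2N$. Then $H_S(x_1,\dots,x_N;\bm{z})=F_S(x_1,\dots,x_N;\bm{z})$.
   Context: **Weights.** All parameters ($q$ and the spectral parameters) are generic/indeterminates; all identities are between rational functions. For $i,j,k,\ell\in\{0,1,2\}$ the Izergin--Korepin vertex weight $W_{y/x}(i,j;k,\ell)$ ($i$ = bottom incoming state, $j$ = left incoming state, $k$ = top outgoing state, $\ell$ = right outgoing state; $x$ = parameter of the horizontal line, $y$ = parameter of the vertical line) depends on $x,y$ only through $y/x$, and, with $D=(x-q^2y)(x-q^3y)$, is given by $W(0,0;0,0)=W(2,2;2,2)=1$; $W(1,0;1,0)=W(2,1;2,1)=\frac{q^2(x-y)}{x-q^2y}$; $W(1,0;0,1)=W(2,1;1,2)=\frac{(1-q^2)x}{x-q^2y}$; $W(0,1;1,0)=W(1,2;2,1)=\frac{(1-q^2)y}{x-q^2y}$; $W(0,1;0,1)=W(1,2;1,2)=\frac{x-y}{x-q^2y}$; $W(2,0;2,0)=\frac{q^4(x-y)(x-qy)}{D}$; $W(2,0;1,1)=-\frac{q(1-q)^2(1+q)x(x-y)}{D}$; $W(2,0;0,2)=\frac{(1-q^2)x(x+qx-qy-q^3y)}{D}$; $W(1,1;2,0)=-\frac{q^4(1+q)(x-y)y}{D}$; $W(1,1;1,1)=\frac{-qx^2+(1+q)(1-q^2+q^4)xy-q^4y^2}{D}$; $W(1,1;0,2)=\frac{(1+q)x(x-y)}{D}$; $W(0,2;2,0)=\frac{(1-q^2)(x+q^2x-q^2y-q^3y)y}{D}$;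 $W(0,2;1,1)=\frac{q(1-q)^2(1+q)(x-y)y}{D}$; $W(0,2;0,2)=\frac{(x-y)(x-qy)}{D}$; and $W=0$ in all other cases. **2-strings.** A 2-string is an infinite vector $S=(S_1,S_2,\dots)$ with $S_i\in\{0,1,2\}$ and only finitely many nonzero entries; $|S|=\sum_i S_i$. $\bm{z}=(z_1,z_2,\dots)$. **$F_S^I$ and $F_S$.** For $I=(I_1,\dots,I_N)\in\{0,1,2\}^N$ with $|I|=\sum_r I_r=|S|$, choose $L$ with $S_c=0$ for $c>L$ and put $$F_S^I(x_1,\dots,x_N;\bm{z})=\sum\prod_{r=1}^{N}\prod_{c=1}^{L}W_{z_c/x_r}(v_{r-1,c},h_{r,c-1};v_{r,c},h_{r,c}),$$ summed over all $h_{r,c}\in\{0,1,2\}$ ($1\le r\le N$, $0\le c\le L$) and $v_{r,c}\in\{0,1,2\}$ ($0\le r\le N$, $1\le c\le L$) with $h_{r,0}=I_r$, $h_{r,L}=0$, $v_{0,c}=0$, $v_{N,c}=S_c$ (independent of $L$). For $|S|=2N$, $F_S:=F_S^{(2^N)}$. **$H_S$.** For $0\le K\le N$ and $|S|=2K$, $$H_S(x_1,\dots,x_N;\bm{z})=\sum_{I\in\{0,1,2\}^N:\,|I|=2K}(-1)^{\mathfrak{c}_1(I)/2}(1-q^{-1})^{\mathfrak{c}_1(I)}q^{-\mathrm{inv}(I)}F_S^I(x_1,\dots,x_N;\bm{z}),$$ where $\mathfrak{c}_1(I)=\#\{r:I_r=1\}$ and $\mathrm{inv}(I)=\sum_{1\le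 i<j\le N}I_i(2-I_j)$. *)

(* Defs.v *)
From mathcomp Require Import all_boot all_order all_algebra.
From mathcomp Require Import finmap.

Set Implicit Arguments.
Unset Strict Implicit.
Unset Printing Implicit Defensive.

Import GRing.Theory.
Local Open Scope ring_scope.

Definition state := 'I_3.

Definition st0 : state := @Ordinal 3 0 isT.
Definition st2 : state := @Ordinal 3 2 isT.

(* Izergin--Korepin weight W_{y/x}(i,j;k,l): i bottom, j left (incoming),
   k top, l right (outgoing); x belongs to the horizontal line, y to the
   vertical one. *)
Definition IKweight (F : fieldType) (q x y : F) (i j k l : nat) : F :=
  let d := x - q ^+ 2 * y in
  let D := (x - q ^+ 2 * y) * (x - q ^+ 3 * y) in
  match (i, j, k, l) with
  | (0, 0, 0, 0)%N | (2, 2, 2, 2)%N => 1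
  | (1, 0, 1, 0)%N | (2, 1, 2, 1)%N => q ^+ 2 * (x - y) / d
  | (1, 0, 0, 1)%N | (2, 1, 1, 2)%N => (1 - q ^+ 2) * x / d
  | (0, 1, 1, 0)%N | (1, 2, 2, 1)%N => (1 - q ^+ 2) * y / d
  | (0, 1, 0, 1)%N | (1, 2, 1, 2)%N => (x - y) / d
  | (2, 0, 2, 0)%N => q ^+ 4 * (x - y) * (x - q * y) / D
  | (2, 0, 1, 1)%N => - (q * (1 - q) ^+ 2 * (1 + q) * x * (x - y) / D)
  | (2, 0, 0, 2)%N =>
      (1 - q ^+ 2) * x * (x + q * x - q * y - q ^+ 3 * y) / D
  | (1, 1, 2, 0)%N => - (q ^+ 4 * (1 + q) * (x - y) * y / D)
  | (1, 1, 1, 1)%N =>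
      (- (q * x ^+ 2) + (1 + q) * (1 - q ^+ 2 + q ^+ 4) * x * y
       - q ^+ 4 * y ^+ 2) / D
  | (1, 1, 0, 2)%N => (1 + q) * x * (x - y) / D
  | (0, 2, 2, 0)%N =>
      (1 - q ^+ 2) * (x + q ^+ 2 * x - q ^+ 2 * y - q ^+ 3 * y) * y / D
  | (0, 2, 1, 1)%N => q * (1 - q) ^+ 2 * (1 + q) * (x - y) * y / D
  | (0, 2, 0, 2)%N => (x - y) * (x - q * y) / D
  | _ => 0
  end.

(* Positions and columns are numbered from 0: S c is the (c+1)-st entry. *)
Definition string2 := {fsfun nat -> state with st0}.

Definition string2_weight (S : string2) : nat :=
  (\sum_(c <- finsupp S) S c)%N.

(* The least L such that S c = 0 for all c >= L. *)
Definition string2_len (S : string2) : nat :=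
  (\max_(c <- finsupp S) c.+1)%N.

Definition word_weight (N : nat) (I : {ffun 'I_N -> state}) : nat :=
  (\sum_(r < N) I r)%N.

Section PartitionFunctions.

Variables (F : fieldType) (q : F) (N : nat) (x : 'I_N -> F) (z : nat -> F).

(* With 0-based rows and columns, the vertex (r, c) has left and right edges
   h r c, h r c.+1 and bottom and top edges v r c, v r.+1 c: here
   [widen_ord (leqnSn _) i] has value i and [lift ord0 i] has value i.+1. *)
Definition FI_upto (L : nat) (S : string2) (I : {ffun 'I_N -> state}) : F :=
  \sum_(h : 'M[state]_(N, L.+1) |
          [forall r, (h r ord0 == I r) && (h r ord_max == st0)])
  \sum_(v : 'M[state]_(N.+1, L) |
          [forall c, (v ord0 c == st0) && (v ord_max c == S c)])
  \prod_(r < N) \prod_(c < L)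
    IKweight q (x r) (z c)
      (v (widen_ord (leqnSn N) r) c) (h r (widen_ord (leqnSn L) c))
      (v (lift ord0 r) c) (h r (lift ord0 c)).

(* Any larger L gives the same value: a column with zero bottom and top states
   and zero right states forces all its edges to be 0 and contributes 1. *)
Definition FI (S : string2) (I : {ffun 'I_N -> state}) : F :=
  FI_upto (string2_len S) S I.

Definition FS (S : string2) : F := FI S [ffun=> st2].

Definition word_ones (I : {ffun 'I_N -> state}) : nat :=
  #|[set r | I r == 1%N :> nat]|.

Definition word_inv (I : {ffun 'I_N -> state}) : nat :=
  (\sum_(i < N) \sum_(j < N | i < j) I i * (2 - I j))%N.

(* Used only when the weight of S is even; then so is [word_ones I] for every I in
   the sum, and the halving is exact. *)
Definition HS (S : string2) : F :=
  \sum_(I : {ffun 'I_N -> state} | word_weight I == string2_weight S)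
    (-1) ^+ (word_ones I)./2 * (1 - q^-1) ^+ word_ones I * q ^- word_inv I * FI S I.

End PartitionFunctions.

(* Main.v *)
Require Import Defs.
From mathcomp Require Import all_boot all_order all_algebra.
From mathcomp Require Import finmap.

(** The letters of a word of length [N] are at most 2, so a word of weight [2N]
    is the constant word [2^N] ([word_weight_max]). The sum defining [H_S]
    therefore has a single term, the one that defines [F_S]; its coefficient is 1
    because [2^N] has no letter 1 and every factor [2 - I_j] in its inversion
    number vanishes. The weights of the vertices play no role. *)

Local Open Scope ring_scope.

Lemma word_weight_max (N : nat) (I : {ffun 'I_N -> state}) :
  (word_weight I == 2 * N)%N = (I == [ffun=> st2]).
Proof.
have I_le2 r : (I r <= 2)%N by rewrite -ltnS ltn_ord.
have -> : (2 * N = \sum_(r < N) 2)%N by rewrite sum_nat_const card_ord mulnC.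
have /leqif_sum/= weight_leif :
    forall r : 'I_N, true -> (I r <= 2 ?= iff (I r == st2))%N.
  by move=> r _; split; [exact: I_le2 | rewrite -val_eqE].
rewrite weight_leif; apply/forallP/eqP => [I2 | -> r].
  by apply/ffunP => r; rewrite ffunE; apply/eqP; exact: I2.
by rewrite ffunE.
Qed.

Lemma word_ones_max (N : nat) :
  word_ones ([ffun=> st2] : {ffun 'I_N -> state}) = 0%N.
Proof. by apply: eq_card0 => r; rewrite !inE ffunE. Qed.

Lemma word_inv_max (N : nat) :
  word_inv ([ffun=> st2] : {ffun 'I_N -> state}) = 0%N.
Proof. by apply: big1 => i _; apply: big1 => j _; rewrite !ffunE. Qed.

Theorem proposition1p7p1 (F : fieldType) (N : nat) (hN : (1 <= N)%N)
    (q : F) (x : 'I_N -> F) (z : nat -> F)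
    (hq : q != 0)
    (hxz2 : forall (r : 'I_N) (c : nat), x r - q ^+ 2 * z c != 0)
    (hxz3 : forall (r : 'I_N) (c : nat), x r - q ^+ 3 * z c != 0)
    (S : string2) (hS : string2_weight S = (2 * N)%N) :
  HS q x z S = FS q x z S.
Proof.
rewrite /HS hS (eq_bigl (pred1 [ffun=> st2])); last exact: word_weight_max.
rewrite big_pred1_eq word_ones_max word_inv_max /=.
by rewrite !GRing.expr0 GRing.invr1 !GRing.mul1r.
Qed.
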